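(* Fix integers $m>1$ and $n\ge 1$. For $i=1,\dots,n$ let $h_i:\mathbb{R}\to[0,\infty)$ be measurable, and let $$F_i=\begin{pmatrix} A_i & B_i\\ -B_i & A_i\end{pmatrix}\in\mathbb{R}^{2m\times 2m},$$ where each $A_i\in\mathbb{R}^{m\times m}$ is symmetric and each $B_i\in\mathbb{R}^{m\times m}$ is antisymmetric ($B_i^\top=-B_i$). Suppose that $(x,y)\mapsto \prod_{i=1}^n h_i\big((x^\top,y^\top)F_i(x,y)^\top\big)$ is integrable over $\mathbb{R}^{2m}$ with positive integral, and let $X=(X_1,\dots,X_m)$, $Y=(Y_1,\dots,Y_m)$ be random vectors in $\mathbb{R}^m$ with joint density $$f_{X,Y}(x,y)=K\prod_{i=1}^n h_i\big((x^\top,y^\top)F_i(x,y)^\top\big),$$ $K$ being the normalizing constant. Let $w=(w_1,\dots,w_m)$ be deterministic with $w_j\ge 0$ for all $j$ and $\sum_{j=1}^m w_j=1$. Then $Z=\sum_{j=1}^m w_j\,X_j/Y_j$ has the standard Cauchy distribution. Moreover, for each $1\le j\le m$, $X_j/Y_j$ has the standard Cauchy distribution.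
   Context: The standard Cauchy distribution $\mathrm{Cauchy}(0,1)$ is the distribution on $\mathbb{R}$ with density $\frac{1}{\pi(1+z^2)}$. (Note $Y_j\neq 0$ almost surely since $(X,Y)$ has a density.) *)

(* Defs.v *)
From HB Require Import structures.
From mathcomp Require Import all_boot all_order all_algebra.
From mathcomp Require Import all_classical all_reals all_analysis.
Set Implicit Arguments. Unset Strict Implicit. Unset Printing Implicit Defensive.
Import Order.TTheory GRing.Theory Num.Theory.
Local Open Scope ring_scope.
Local Open Scope classical_set_scope.

(* Iterated Lebesgue integral of a (nonnegative) extended-real function on
   R^k, represented as k.-tuple R (which carries the product sigma-algebra
   generated by the coordinate projections).  This is the integral against
   k-dimensional Lebesgue measure (Tonelli). *)
Fixpoint iint (R : realType) (k : nat) : (k.-tuple R -> \bar R) -> \bar R :=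
  match k return (k.-tuple R -> \bar R) -> \bar R with
  | 0 => fun f => f [tuple]
  | k'.+1 => fun f =>
      (\int[@lebesgue_measure R]_x iint (fun t : k'.-tuple R => f (cons_tuple x t)))%E
  end.

Definition row_of_tuple (R : realType) (k : nat) (z : k.-tuple R) : 'rV[R]_k :=
  \row_(i < k) tnth z i.

Definition blockF (R : realType) (m : nat) (A B : 'M[R]_m) : 'M[R]_(m + m) :=
  block_mx A B (- B) A.

Definition qform (R : realType) (k : nat) (F : 'M[R]_k) (v : 'rV[R]_k) : R :=
  (v *m F *m v^T) 0 0.

Definition joint (R : realType) (T : Type) (m : nat) (X Y : 'I_m -> T -> R)
  (t : T) : (m + m).-tuple R :=
  mktuple (fun i : 'I_(m + m) =>
    match fintype.split i with inl j => X j t | inr j => Y j t end).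

Definition cauchy_pdf (R : realType) (z : R) : R := (pi * (1 + z ^+ 2))^-1.

Definition is_std_cauchy (R : realType) d (T : measurableType d)
  (P : probability T R) (Z : T -> R) : Prop :=
  forall B : set R, measurable B ->
    P (Z @^-1` B) = (\int[@lebesgue_measure R]_(z in B) (cauchy_pdf z)%:E)%E.

(* Main.v *)
Require Import Defs.
From HB Require Import structures.
From mathcomp Require Import all_boot all_order all_algebra.
From mathcomp Require Import all_classical all_reals all_analysis.
From mathcomp Require Import measurable_realfun ring lra.
Set Implicit Arguments. Unset Strict Implicit. Unset Printing Implicit Defensive.
Import Order.TTheory GRing.Theory Num.Theory.
Import numFieldNormedType.Exports.
Local Open Scope ring_scope.
Local Open Scope classical_set_scope.

(** Write (x_j, y_j) in polar form, so that x_j / y_j = tan a_j. The block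
    matrices commute with the complex structure, hence the density is invariant
    under the simultaneous rotations of all the pairs (x_j, y_j), which act by
    a_j |-> a_j - t. Averaging over t in ]-pi/2, pi/2[ and exchanging integrals,
    it suffices to see that for fixed angles a_j and t uniform the mean
    phi t = \sum_j w_j tan (a_j - t) is standard Cauchy.

    To this end phi is extended to the unit disc by an analytic function
    hX + i hY with values in the upper half-plane and value i at the center.
    Up to the additive constant pi / 2, the function hU = atan ((z - hX) / hY) is
    the argument of hX + i hY - z. It is bounded and harmonic, its mean over the
    circle of radius r < 1 is its value atan z at the center, and its boundary
    values are pi / 2 where phi < z and - pi / 2 where phi > z. *)

(** * Iterated Lebesgue integrals on tuples *)

Lemma eq_iint (R : realType) (k : nat) (f g : k.-tuple R -> \bar R) :
  f =1 g -> iint f = iint g.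
Proof. by move=> /funext ->. Qed.

Lemma iint_ge0 (R : realType) (k : nat) (f : k.-tuple R -> \bar R) :
  (forall z, 0 <= f z)%E -> (0 <= iint f)%E.
Proof.
elim: k f => [|k IH] f f0 /=; first exact: f0.
by apply: integral_ge0 => x _; exact: IH.
Qed.

Lemma measurable_fun_cons_tuple (R : realType) (d : measure_display)
    (T : measurableType d) (k : nat) (f : T -> R) (g : T -> k.-tuple R) :
  measurable_fun setT f -> measurable_fun setT g ->
  measurable_fun setT (fun a => cons_tuple (f a) (g a)).
Proof.
move=> mf mg; apply/measurable_fun_tnthP => i.
case: (unliftP ord0 i) => [j|] ->.
  rewrite (_ : _ \o _ = (fun z => tnth z j) \o g).
    exact: measurableT_comp (measurable_tnth _) mg.
  by apply/funext => a /=; rewrite tnthS.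
by rewrite (_ : _ \o _ = f)//; apply/funext => a /=; rewrite tnth0.
Qed.

(** The parameter space [T] is arbitrary so that the induction can absorb the outermost coordinate
    into the parameter, passing from [T] to [T * R]. *)
Lemma measurable_iint (R : realType) (d : measure_display)
    (T : measurableType d) (k : nat) (f : T * k.-tuple R -> \bar R) :
  measurable_fun setT f -> (forall z, 0 <= f z)%E ->
  measurable_fun setT (fun a => iint (fun t => f (a, t))).
Proof.
elim: k d T f => [|k IH] d T f mf f0 /=.
  by apply: (measurableT_comp mf); exact: pair2_measurable.
pose h (ax : T * R) := iint (fun t : k.-tuple R => f (ax.1, cons_tuple ax.2 t)).
have h0 ax : (0 <= h ax)%E by apply: iint_ge0.
have mh : measurable_fun setT h.
  apply: (IH _ _ (fun axt : (T * R) * k.-tuple R =>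
     f (axt.1.1, cons_tuple axt.1.2 axt.2))) => //.
  apply: (measurableT_comp mf); apply: measurable_fun_pair.
    exact: measurableT_comp.
  apply: measurable_fun_cons_tuple => //.
  exact: measurableT_comp.
have := @measurable_fun_fubini_tonelli_F _ _ T (measurableTypeR R) R
  (@lebesgue_measure R) h.
by apply.
Qed.

(** Tonelli, applied to one coordinate at a time; nonnegativity of [f] stands in for
    integrability. *)
Lemma integral_iint (R : realType) (d : measure_display) (T : measurableType d)
    (nu : {sigma_finite_measure set T -> \bar R}) (k : nat)
    (f : T * k.-tuple R -> \bar R) :
  measurable_fun setT f -> (forall z, 0 <= f z)%E ->
  (\int[nu]_a iint (fun t => f (a, t)) =
   iint (fun t => \int[nu]_a f (a, t)))%E.
Proof.
elim: k f => [//|k IH] f mf f0 /=.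
pose h (ax : T * R) := iint (fun t : k.-tuple R => f (ax.1, cons_tuple ax.2 t)).
have h0 ax : (0 <= h ax)%E by apply: iint_ge0.
have mh : measurable_fun setT h.
  apply: (@measurable_iint _ _ _ _ (fun axt : (T * R) * k.-tuple R =>
     f (axt.1.1, cons_tuple axt.1.2 axt.2))) => //.
  apply: (measurableT_comp mf); apply: measurable_fun_pair.
    exact: measurableT_comp.
  apply: measurable_fun_cons_tuple => //.
  exact: measurableT_comp.
rewrite (@fubini_tonelli _ _ T (measurableTypeR R) R nu (@lebesgue_measure R) h)//.
apply: eq_integral => x _.
rewrite (IH (fun at_ : T * k.-tuple R => f (at_.1, cons_tuple x at_.2)))//.
apply: (measurableT_comp mf); apply: measurable_fun_pair => //.
exact: measurable_fun_cons_tuple.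
Qed.

Lemma measurable_fun_cat_tuple (R : realType) (d : measure_display)
    (T : measurableType d) (j k : nat) (f : T -> j.-tuple R)
    (g : T -> k.-tuple R) :
  measurable_fun setT f -> measurable_fun setT g ->
  measurable_fun setT (fun a => cat_tuple (f a) (g a)).
Proof.
move=> mf mg; apply/measurable_fun_tnthP => i.
case: (split_ordP i) => l ->.
  rewrite (_ : _ \o _ = (fun z => tnth z l) \o f).
    exact: measurableT_comp (measurable_tnth _) mf.
  by apply/funext => a /=; rewrite tnth_lshift.
rewrite (_ : _ \o _ = (fun z => tnth z l) \o g).
  exact: measurableT_comp (measurable_tnth _) mg.
by apply/funext => a /=; rewrite tnth_rshift.
Qed.

Lemma iint_cat (R : realType) (j k : nat) (f : (j + k).-tuple R -> \bar R) :
  iint f = iint (fun x : j.-tuple R => iint (fun y : k.-tuple R =>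
    f (cat_tuple x y))).
Proof.
elim: j f => [|j IH] f /=.
  by apply: eq_iint => y; congr (f _); exact: val_inj.
apply: eq_integral => x _; rewrite IH; apply: eq_iint => t; apply: eq_iint => y.
by congr (f _); exact: val_inj.
Qed.

Lemma iint_exchange (R : realType) (j k : nat)
    (f : j.-tuple R * k.-tuple R -> \bar R) :
  measurable_fun setT f -> (forall z, 0 <= f z)%E ->
  iint (fun x => iint (fun y => f (x, y))) =
  iint (fun y => iint (fun x => f (x, y))).
Proof.
elim: j f => [//|j IH] f mf f0 /=.
rewrite -(@integral_iint _ _ _ (@lebesgue_measure R) _ (fun xy : R * k.-tuple R =>
    iint (fun t : j.-tuple R => f (cons_tuple xy.1 t, xy.2)))).
- apply: eq_integral => x _.
  rewrite (IH (fun ty : j.-tuple R * k.-tuple R => f (cons_tuple x ty.1, ty.2)))//.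
  apply: (measurableT_comp mf); apply: measurable_fun_pair => //.
  exact: measurable_fun_cons_tuple.
- apply: (@measurable_iint _ _ _ _ (fun xyt : (R * k.-tuple R) * j.-tuple R =>
    f (cons_tuple xyt.1.1 xyt.2, xyt.1.2))) => //.
  apply: (measurableT_comp mf); apply: measurable_fun_pair => //.
    by apply: measurable_fun_cons_tuple => //; exact: measurableT_comp.
  exact: measurableT_comp.
- by move=> z; exact: iint_ge0.
Qed.

(** A translation preserves the length of half-open intervals, and Lebesgue measure is determined by
    these lengths. *)
Lemma lebesgue_measure_translation (R : realType) (c : R) (A : set R) :
  measurable A ->
  pushforward (@lebesgue_measure R)
    ((fun x => x + c) : R -> measurableTypeR R) A = lebesgue_measure A.
Proof.
move=> mA; apply/esym/lebesgue_measure_unique => //=; first exact: measurable_funD.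
move=> _ _ [[a b]] _ <-.
rewrite /pushforward/= (_ : _ @^-1` _ = `]a - c, b - c]%classic).
  rewrite !lebesgue_measure_itv/= !lte_fin ltrD2r; case: ifP => // _.
  by rewrite -!EFinB opprB addrA subrK.
by apply/seteqP; split => x /=; rewrite !in_itv/= ltrBlDr lerBrDr.
Qed.

Lemma ge0_integral_translation (R : realType) (c : R) (f : R -> \bar R) :
  measurable_fun setT f -> (forall x, 0 <= f x)%E ->
  (\int[@lebesgue_measure R]_x f (x + c)%R = \int[@lebesgue_measure R]_x f x)%E.
Proof.
move=> mf f0.
have mc : measurable_fun setT ((fun x => x + c) : measurableTypeR R -> measurableTypeR R).
  exact: measurable_funD.
have := @ge0_integral_pushforward _ _ (measurableTypeR R) (measurableTypeR R) R
  (fun x => x + c) mc (@lebesgue_measure R) setT f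
  measurableT mf (fun y _ => f0 y).
rewrite preimage_setT => <-.
by apply: eq_measure_integral => //= A mA _; exact: lebesgue_measure_translation.
Qed.

Lemma iint_translation (R : realType) (k : nat) (c : 'I_k -> R)
    (f : k.-tuple R -> \bar R) :
  measurable_fun setT f -> (forall z, 0 <= f z)%E ->
  iint (fun z => f [tuple tnth z i + c i | i < k]) = iint f.
Proof.
elim: k c f => [|k IH] c f mf f0 /=.
  by congr (f _); rewrite tuple0; apply: val_inj.
rewrite -[RHS](ge0_integral_translation (c ord0)).
- apply: eq_integral => x _.
  rewrite -[RHS](IH (fun i => c (lift ord0 i))).
  + apply: eq_iint => t; congr (f _); apply: eq_from_tnth => i.
    rewrite tnth_mktuple; case: (unliftP ord0 i) => [j|] ->.
      by rewrite !tnthS tnth_mktuple.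
    by rewrite !tnth0.
  + apply: (measurableT_comp mf); exact: measurable_fun_cons_tuple.
  + by move=> z; exact: f0.
- apply: (@measurable_iint _ _ _ _ (fun xt : R * k.-tuple R =>
    f (cons_tuple xt.1 xt.2))) => //.
  apply: (measurableT_comp mf); exact: measurable_fun_cons_tuple.
- by move=> x; exact: iint_ge0.
Qed.

(** The discarded set is the union of the coordinate hyperplanes: each level of the iteration loses
    only the point 0. This is how vanishing denominators are excluded later. *)
Lemma iint_eq_nonzero (R : realType) (k : nat) (f g : k.-tuple R -> \bar R) :
  measurable_fun setT f -> measurable_fun setT g ->
  (forall z, 0 <= f z)%E -> (forall z, 0 <= g z)%E ->
  (forall z, (forall i, tnth z i != 0) -> f z = g z) ->
  iint f = iint g.
Proof.
elim: k f g => [|k IH] f g mf mg f0 g0 fg /=; first by apply: fg => -[].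
have mcons (h : k.+1.-tuple R -> \bar R) : measurable_fun setT h ->
    (forall z, 0 <= h z)%E -> measurable_fun setT
      (fun x => iint (fun t : k.-tuple R => h (cons_tuple x t))).
  move=> mh h0; apply: (@measurable_iint _ _ _ _ (fun xt : R * k.-tuple R =>
    h (cons_tuple xt.1 xt.2))) => //.
  apply: (measurableT_comp mh); exact: measurable_fun_cons_tuple.
apply: ge0_ae_eq_integral => //.
- exact: mcons.
- exact: mcons.
- by move=> x _; exact: iint_ge0.
- by move=> x _; exact: iint_ge0.
exists [set 0]; split => //; first exact: lebesgue_measure_set1.
move=> x /= /not_implyP[_ H]; apply: contrapT => /eqP x0; apply: H.
apply: IH => //.
- apply: (measurableT_comp mf); exact: measurable_fun_cons_tuple.
- apply: (measurableT_comp mg); exact: measurable_fun_cons_tuple.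
move=> t t0; apply: fg => i; case: (unliftP ord0 i) => [j|] ->.
  by rewrite tnthS.
by rewrite tnth0.
Qed.

Lemma iintZl (R : realType) (k : nat) (c : \bar R) (f : k.-tuple R -> \bar R) :
  measurable_fun setT f -> (0 <= c)%E -> (forall z, 0 <= f z)%E ->
  iint (fun z => c * f z)%E = (c * iint f)%E.
Proof.
elim: k f => [//|k IH] f mf c0 f0 /=.
rewrite -ge0_integralZl//=.
- apply: eq_integral => x _; apply: IH => //.
  apply: (measurableT_comp mf); exact: measurable_fun_cons_tuple.
- apply: (@measurable_iint _ _ _ _ (fun xt : R * k.-tuple R =>
    f (cons_tuple xt.1 xt.2))) => //.
  apply: (measurableT_comp mf); exact: measurable_fun_cons_tuple.
- by move=> x _; exact: iint_ge0.
Qed.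

Lemma measurable_fun_mktuple (R : realType) (d : measure_display)
    (T : measurableType d) (k : nat) (f : 'I_k -> T -> R) :
  (forall i, measurable_fun setT (f i)) ->
  measurable_fun setT (fun a => [tuple f i a | i < k]).
Proof.
move=> mf; apply/measurable_fun_tnthP => i.
rewrite (_ : _ \o _ = f i)//.
by apply/funext => a /=; rewrite tnth_mktuple.
Qed.

Lemma measurable_fun_tnth (R : realType) (d : measure_display)
    (T : measurableType d) (k : nat) (f : T -> k.-tuple R) (i : 'I_k) :
  measurable_fun setT f -> measurable_fun setT (fun a => tnth (f a) i).
Proof. by move=> mf; exact: measurableT_comp (measurable_tnth i) mf. Qed.

(** * Invariance of Lebesgue measure under simultaneous rotations of the pairs *)

Section rotation.
Variables (R : realType) (m : nat).
Implicit Types (x y : m.-tuple R) (f : m.-tuple R * m.-tuple R -> \bar R).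

Definition tuple_axpy (c : R) x y : m.-tuple R :=
  [tuple tnth x i + c * tnth y i | i < m].

Lemma measurable_fun_tuple_axpy (c : R) (d : measure_display)
    (T : measurableType d) (f g : T -> m.-tuple R) :
  measurable_fun setT f -> measurable_fun setT g ->
  measurable_fun setT (fun a => tuple_axpy c (f a) (g a)).
Proof.
move=> mf mg; apply: measurable_fun_mktuple => i.
apply: measurable_funD; first exact: measurable_fun_tnth.
by apply: measurable_funM => //; exact: measurable_fun_tnth.
Qed.

(** For fixed x the shear is a translation in y. *)
Lemma iint_shear2 (c : R) f :
  measurable_fun setT f -> (forall z, 0 <= f z)%E ->
  iint (fun x => iint (fun y => f (x, tuple_axpy c y x))) =
  iint (fun x => iint (fun y => f (x, y))).
Proof.
move=> mf f0; apply: eq_iint => x.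
rewrite -[RHS](iint_translation (fun i => c * tnth x i))//.
by apply: (measurableT_comp mf); exact: measurable_fun_pair.
Qed.

(** Exchanging the two blocks of variables reduces this to the other shear. *)
Lemma iint_shear1 (c : R) f :
  measurable_fun setT f -> (forall z, 0 <= f z)%E ->
  iint (fun x => iint (fun y => f (tuple_axpy c x y, y))) =
  iint (fun x => iint (fun y => f (x, y))).
Proof.
move=> mf f0.
rewrite (iint_exchange mf f0).
rewrite (@iint_exchange _ _ _ (fun xy => f (tuple_axpy c xy.1 xy.2, xy.2)))//.
  apply: (@iint_shear2 c (fun yx => f (yx.2, yx.1))) => //.
  by apply: (measurableT_comp mf); exact: measurable_fun_pair.
apply: (measurableT_comp mf); apply: measurable_fun_pair => //.
exact: measurable_fun_tuple_axpy.
Qed.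

Definition tuple_comb (a b : R) x y : m.-tuple R :=
  [tuple a * tnth x i + b * tnth y i | i < m].

(* A rotation by an angle other than pi is a product of three shears. *)
Lemma iint_rotation (c s : R) f : c ^+ 2 + s ^+ 2 = 1 -> 1 + c != 0 ->
  measurable_fun setT f -> (forall z, 0 <= f z)%E ->
  iint (fun x => iint (fun y => f (tuple_comb c (- s) x y, tuple_comb s c x y)))
  = iint (fun x => iint (fun y => f (x, y))).
Proof.
(* [t] is the tangent of half the angle. The shears are x - t y, then y + s x, then x - t y
   again. *)
move=> cs c1 mf f0; pose t := s / (1 + c).
have ts : s * t = 1 - c.
  rewrite /t mulrA -expr2; apply: (mulIf c1); rewrite divfK//.
  have -> : s ^+ 2 = (c ^+ 2 + s ^+ 2) - c ^+ 2 by ring.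
  by rewrite cs; ring.
have tc : t * (1 + c) = s by rewrite /t divfK.
rewrite -[RHS](iint_shear1 (- t))//.
rewrite -[RHS](@iint_shear2 s (fun xy => f (tuple_axpy (- t) xy.1 xy.2, xy.2)))//; last first.
  apply: (measurableT_comp mf); apply: measurable_fun_pair => //.
  exact: measurable_fun_tuple_axpy.
rewrite -[RHS](@iint_shear1 (- t) (fun xy => 
  f (tuple_axpy (- t) xy.1 (tuple_axpy s xy.2 xy.1), tuple_axpy s xy.2 xy.1)))//; last first.
  apply: (measurableT_comp mf); apply: measurable_fun_pair => //.
    by apply: measurable_fun_tuple_axpy => //; exact: measurable_fun_tuple_axpy.
  exact: measurable_fun_tuple_axpy.
apply: eq_iint => x; apply: eq_iint => y; congr (f (_, _)) => /=;
  apply: eq_from_tnth => i; rewrite !tnth_mktuple; set u := tnth x i; set v := tnth y i.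
- have -> : u + - t * v + - t * (v + s * (u + - t * v)) =
    (1 - s * t) * u - t * (1 + (1 - s * t)) * v by ring.
  by rewrite ts subKr tc mulNr.
- have -> : v + s * (u + - t * v) = s * u + (1 - s * t) * v by ring.
  by rewrite ts subKr.
Qed.

End rotation.

(** * Harmonic extension to the disc *)

Section derive_pointwise.
Variable R : realType.
Implicit Types (f g : R -> R) (x c df dg : R).

(** Separates the derivative that the rules produce from the closed form wanted, leaving an
    algebraic identity. *)
Lemma is_derive_congr f x df dg : is_derive x 1 f df -> df = dg ->
  is_derive x 1 f dg.
Proof. by move=> ? <-. Qed.

Lemma is_derive_add f g x df dg : is_derive x 1 f df -> is_derive x 1 g dg ->
  is_derive x 1 (fun t => f t + g t) (df + dg).
Proof. exact: is_deriveD. Qed.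

Lemma is_derive_opp f x df : is_derive x 1 f df ->
  is_derive x 1 (fun t => - f t) (- df).
Proof. exact: is_deriveN. Qed.

Lemma is_derive_scale f x c df : is_derive x 1 f df ->
  is_derive x 1 (fun t => c * f t) (c * df).
Proof. exact: is_deriveZ. Qed.

Lemma is_derive_mul f g x df dg : is_derive x 1 f df -> is_derive x 1 g dg ->
  is_derive x 1 (fun t => f t * g t) (df * g x + f x * dg).
Proof.
move=> hf hg; have H := is_deriveM hf hg.
rewrite (_ : _ + _ = f x *: dg + g x *: df)//.
by rewrite /GRing.scale/= addrC; congr (_ + _); rewrite mulrC.
Qed.

Lemma is_derive_div f g x df dg : g x != 0 ->
  is_derive x 1 f df -> is_derive x 1 g dg ->
  is_derive x 1 (fun t => f t / g t) ((df * g x - f x * dg) / g x ^+ 2).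
Proof.
move=> gx hf hg.
have hV : is_derive x 1 (fun t => (g t)^-1) (- g x ^- 2 * dg).
  exact: is_deriveV gx hg.
by apply: (is_derive_congr (is_derive_mul hf hV)); field.
Qed.

Lemma is_derive_bigsum n (h : 'I_n -> R -> R) (dh : 'I_n -> R) x :
  (forall i, is_derive x 1 (h i) (dh i)) ->
  is_derive x 1 (fun t => \sum_(i < n) h i t) (\sum_(i < n) dh i).
Proof.
move=> H; rewrite (_ : (fun t => _) = \sum_(i < n) h i).
  exact: is_derive_sum.
by apply/funext => t; rewrite fct_sumE.
Qed.

Lemma is_derive_continuous f x df : is_derive x 1 f df -> {for x, continuous f}.
Proof.
by move=> hf; apply: differentiable_continuous; apply/derivable1_diffP; exact: ex_derive.
Qed.

End derive_pointwise.

(** * The extension of a single tangent to the disc *)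

Section poisson.
Variable R : realType.
Implicit Types a r t : R.

(* [px + i py = i (1 - q) / (1 + q)] with [q = r e^(2 i (a - t))], which is
   [tan (a - t)] for [r = 1]; [dpx] and [dpy] are the derivatives in [r]. *)
Definition pden a r t := 1 + 2 * r * cos (2 * (a - t)) + r ^+ 2.
Definition px a r t := 2 * r * sin (2 * (a - t)) / pden a r t.
Definition py a r t := (1 - r ^+ 2) / pden a r t.
Definition dpx a r t := 2 * sin (2 * (a - t)) * (1 - r ^+ 2) / pden a r t ^+ 2.
Definition dpy a r t :=
  - 2 * (2 * r + cos (2 * (a - t)) * (1 + r ^+ 2)) / pden a r t ^+ 2.

(** [pden] is the squared modulus of 1 + q, and |q| = |r|, so this is the reverse triangle
    inequality. *)
Lemma pden_ge a r t : (1 - `|r|) ^+ 2 <= pden a r t.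
Proof.
rewrite /pden; have := cos_max (2 * (a - t)); set c := cos _ => c1.
have : - (`|r| * `|c|) <= r * c by rewrite -normrM lerNl -normrN ler_norm.
rewrite -(real_normK (num_real r)); have := normr_ge0 r; set q := `|r|.
by move=> *; nra.
Qed.

Lemma pden_gt0 a r t : `|r| < 1 -> 0 < pden a r t.
Proof.
move=> r1; apply: lt_le_trans (pden_ge _ _ _).
by rewrite exprn_gt0// subr_gt0.
Qed.

Lemma is_derive_angle a t : is_derive t 1 (fun t => 2 * (a - t)) (- 2).
Proof.
have H := is_derive_scale 2 (is_derive_add (is_derive_cst a t 1) (is_deriveNid t 1)).
by apply: (is_derive_congr H); rewrite add0r mulrN1.
Qed.

Lemma is_derive_cos_angle a t :
  is_derive t 1 (fun t => cos (2 * (a - t))) (2 * sin (2 * (a - t))).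
Proof.
apply: (is_derive_congr (is_derive1_comp (is_derive_cos _) (is_derive_angle a t))).
by rewrite mulrNN mulrC.
Qed.

Lemma is_derive_sin_angle a t :
  is_derive t 1 (fun t => sin (2 * (a - t))) (- 2 * cos (2 * (a - t))).
Proof.
apply: (is_derive_congr (is_derive1_comp (is_derive_sin _) (is_derive_angle a t))).
by rewrite mulrC.
Qed.

Lemma is_derive_sqr r : is_derive r 1 (fun r => r ^+ 2) (2 * r).
Proof.
have H := is_derive_mul (is_derive_id r 1) (is_derive_id r 1).
by apply: (is_derive_congr H); rewrite /cst/=; ring.
Qed.

Lemma is_derive_pden1 a r t :
  is_derive r 1 (fun r => pden a r t) (2 * cos (2 * (a - t)) + 2 * r).
Proof.
have H := is_derive_add (is_derive_add (is_derive_cst (1 : R) r 1)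
  (is_derive_mul (is_derive_scale 2 (is_derive_id r 1))
     (is_derive_cst (cos (2 * (a - t))) r 1))) (is_derive_sqr r).
by apply: (is_derive_congr H); rewrite /cst/=; ring.
Qed.

Lemma is_derive_pden2 a r t :
  is_derive t 1 (fun t => pden a r t) (4 * r * sin (2 * (a - t))).
Proof.
have H := is_derive_add (is_derive_add (is_derive_cst (1 : R) t 1)
  (is_derive_scale (2 * r) (is_derive_cos_angle a t)))
  (is_derive_cst (r ^+ 2) t 1).
by apply: (is_derive_congr H); rewrite /cst/=; ring.
Qed.

Lemma is_derive_px1 a r t : pden a r t != 0 ->
  is_derive r 1 (fun r => px a r t) (dpx a r t).
Proof.
move=> d0.
have H := is_derive_div (g := fun r => pden a r t) d0
  (is_derive_mul (is_derive_scale 2 (is_derive_id r 1))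
     (is_derive_cst (sin (2 * (a - t))) r 1)) (is_derive_pden1 a r t).
by apply: (is_derive_congr H); congr (_ / _); rewrite /pden /cst/=; ring.
Qed.

Lemma is_derive_py1 a r t : pden a r t != 0 ->
  is_derive r 1 (fun r => py a r t) (dpy a r t).
Proof.
move=> d0.
have H := is_derive_div (g := fun r => pden a r t) d0
  (is_derive_add (is_derive_cst (1 : R) r 1)
     (is_derive_opp (is_derive_sqr r))) (is_derive_pden1 a r t).
by apply: (is_derive_congr H); congr (_ / _); rewrite /pden /cst/=; ring.
Qed.

(** With [is_derive_py2] below, these are the Cauchy-Riemann equations in polar form. The argument
    of q is 2 (a - t), so d/dt is - 2 times the angular derivative, whence the factor 2 r. *)
Lemma is_derive_px2 a r t : pden a r t != 0 ->
  is_derive t 1 (fun t => px a r t) (2 * r * dpy a r t).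
Proof.
move=> d0.
have H := is_derive_div (g := fun t => pden a r t) d0
  (is_derive_scale (2 * r) (is_derive_sin_angle a t))
  (is_derive_pden2 a r t).
apply: (is_derive_congr H); rewrite /dpy [RHS]mulrA; congr (_ / _); rewrite /pden.
have := cos2Dsin2 (2 * (a - t)); set c := cos _; set s := sin _ => cs.
have -> : 2 * r * (- 2 * c) * (1 + 2 * r * c + r ^+ 2) - 2 * r * s * (4 * r * s)
  = - 4 * r * (c + 2 * r * (c ^+ 2 + s ^+ 2) + r ^+ 2 * c) by ring.
by rewrite cs; ring.
Qed.

Lemma is_derive_py2 a r t : pden a r t != 0 ->
  is_derive t 1 (fun t => py a r t) (- (2 * r) * dpx a r t).
Proof.
move=> d0.
have H := is_derive_div (g := fun t => pden a r t) d0
  (is_derive_cst (1 - r ^+ 2) t 1) (is_derive_pden2 a r t).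
by apply: (is_derive_congr H); rewrite /dpx [RHS]mulrA; congr (_ / _); rewrite /cst/=; ring.
Qed.

End poisson.

(** * The weighted mean of the extensions and its argument seen from z *)

Section harmonic.
Variables (R : realType) (m : nat) (al w : 'I_m -> R) (z : R).
Hypothesis w_ge0 : forall j, 0 <= w j.
Hypothesis w_sum : \sum_(j < m) w j = 1.
Implicit Types r t : R.

Definition hX r t := \sum_(j < m) w j * px (al j) r t.
Definition hY r t := \sum_(j < m) w j * py (al j) r t.
Definition dhX r t := \sum_(j < m) w j * dpx (al j) r t.
Definition dhY r t := \sum_(j < m) w j * dpy (al j) r t.
(** The squared modulus of hX + i hY - z. *)
Definition hQ r t := (z - hX r t) ^+ 2 + hY r t ^+ 2.
Definition hU r t := atan ((z - hX r t) / hY r t).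
Definition dhU r t :=
  (- dhX r t * hY r t - (z - hX r t) * dhY r t) / hQ r t.

Lemma wmean_ge (f : 'I_m -> R) c :
  (forall j, c <= f j) -> c <= \sum_(j < m) w j * f j.
Proof.
move=> cf; rewrite -[leLHS]mul1r -w_sum mulr_suml.
by apply: ler_sum => j _; exact: ler_wpM2l.
Qed.

Lemma norm_wmean_le (f : 'I_m -> R) c :
  (forall j, `|f j| <= c) -> `|\sum_(j < m) w j * f j| <= c.
Proof.
move=> cf; apply: (le_trans (ler_norm_sum _ _ _)).
rewrite -[leRHS]mul1r -w_sum mulr_suml; apply: ler_sum => j _.
by rewrite normrM (ger0_norm (w_ge0 j)) ler_wpM2l.
Qed.

(** The triangle inequality |1 + q| <= 2, squared. *)
Lemma pden_le4 a r t : `|r| < 1 -> pden a r t <= 4.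
Proof.
move=> r1; rewrite /pden; have := cos_max (2 * (a - t)); set c := cos _ => c1.
have : r * c <= `|r| * `|c| by rewrite -normrM ler_norm.
rewrite -(real_normK (num_real r)); move: r1; have := normr_ge0 r; set q := `|r|.
by move=> *; nra.
Qed.

Lemma hY_ge r t : `|r| < 1 -> (1 - r ^+ 2) / 4 <= hY r t.
Proof.
move=> r1; apply: wmean_ge => j; rewrite /py ler_wpM2l//.
  by rewrite subr_ge0 -real_normK ?num_real// exprn_ile1// ltW.
by rewrite lef_pV2 ?posrE ?pden_gt0// pden_le4.
Qed.

Lemma sqr_lt1 r : `|r| < 1 -> r ^+ 2 < 1.
Proof. by move=> r1; rewrite -real_normK ?num_real// exprn_ilt1. Qed.

Lemma hY_gt0 r t : `|r| < 1 -> 0 < hY r t.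
Proof.
move=> r1; apply: lt_le_trans (hY_ge t r1).
by rewrite divr_gt0// subr_gt0 sqr_lt1.
Qed.

Lemma hQ_gt0 r t : `|r| < 1 -> 0 < hQ r t.
Proof.
by move=> r1; rewrite /hQ ltr_wpDl ?sqr_ge0// exprn_gt0// hY_gt0.
Qed.

Let pden_neq0 a r t : `|r| < 1 -> pden a r t != 0.
Proof. by move=> r1; rewrite gt_eqF// pden_gt0. Qed.

Lemma is_derive_hX1 r t : `|r| < 1 ->
  is_derive r 1 (fun r => hX r t) (dhX r t).
Proof.
move=> r1; apply: is_derive_bigsum => j; apply: is_derive_scale.
by apply: is_derive_px1; exact: pden_neq0.
Qed.

Lemma is_derive_hY1 r t : `|r| < 1 ->
  is_derive r 1 (fun r => hY r t) (dhY r t).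
Proof.
move=> r1; apply: is_derive_bigsum => j; apply: is_derive_scale.
by apply: is_derive_py1; exact: pden_neq0.
Qed.

Lemma is_derive_hX2 r t : `|r| < 1 ->
  is_derive t 1 (fun t => hX r t) (2 * r * dhY r t).
Proof.
move=> r1; rewrite mulr_sumr; apply: is_derive_bigsum => j.
rewrite mulrCA; apply: is_derive_scale.
by apply: is_derive_px2; exact: pden_neq0.
Qed.

Lemma is_derive_hY2 r t : `|r| < 1 ->
  is_derive t 1 (fun t => hY r t) (- (2 * r) * dhX r t).
Proof.
move=> r1; rewrite mulr_sumr; apply: is_derive_bigsum => j.
rewrite mulrCA; apply: is_derive_scale.
by apply: is_derive_py2; exact: pden_neq0.
Qed.

Lemma is_derive_hU1 r t : `|r| < 1 ->
  is_derive r 1 (fun r => hU r t) (dhU r t).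
Proof.
move=> r1; have Y0 := hY_gt0 t r1; have Q0 := hQ_gt0 t r1.
have Yn0 : hY r t != 0 by rewrite gt_eqF.
have H1 := is_derive_add (is_derive_cst z r 1) (is_derive_opp (is_derive_hX1 t r1)).
have H := is_derive1_comp (is_derive1_atan _)
  (is_derive_div (g := fun r => hY r t) Yn0 H1 (is_derive_hY1 t r1)).
apply: (is_derive_congr H); rewrite /cst/= /dhU.
move: Q0 Yn0; rewrite /hQ; set q := hX r t; set y := hY r t => Q0 Yn0.
by field; rewrite Yn0 !gt_eqF// addrC.
Qed.

(* [ln hQ] is twice the harmonic conjugate of [hU]: in polar coordinates the
   Cauchy-Riemann equations turn the radial derivative of [hU] into an angular
   derivative, whose mean over a period vanishes. *)
Lemma is_derive_lnQ2 r t : `|r| < 1 ->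
  is_derive t 1 (fun t => ln (hQ r t)) (4 * r * dhU r t).
Proof.
move=> r1; have Q0 := hQ_gt0 t r1.
have H1 := is_derive_add (is_derive_cst z t 1) (is_derive_opp (is_derive_hX2 t r1)).
have H2 := is_derive_hY2 t r1.
have H := is_derive1_comp (is_derive1_ln Q0)
  (is_derive_add (is_derive_mul H1 H1) (is_derive_mul H2 H2)).
apply: (is_derive_congr H); rewrite /cst/= /dhU; field.
by rewrite gt_eqF.
Qed.

(** The bound is uniform in [t] and in |r| <= rho, so that it can dominate when differentiating
    under the integral. The constant is 64 = 8 * 2 * 4: 8 bounds the numerators of [dpx] and [dpy],
    2 comes from (y + q) y <= 2 (y ^ 2 + q ^ 2), and 4 from the lower bound on [hY]. *)
Lemma norm_dhU_le r t rho : `|r| <= rho -> rho < 1 ->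
  `|dhU r t| <= 64 / (1 - rho) ^+ 4 / (1 - rho ^+ 2).
Proof.
move=> rrho rho1; have r1 := le_lt_trans rrho rho1.
have rho0 : 0 <= rho := le_trans (normr_ge0 r) rrho.
set M := 8 / (1 - rho) ^+ 4.
have bd a N : `|N| <= 8 -> `|N / pden a r t ^+ 2| <= M.
  move=> N8; have p0 := pden_gt0 a t r1.
  have pd : (1 - rho) ^+ 2 <= pden a r t.
    apply: le_trans (pden_ge a r t); rewrite lerXn2r ?nnegrE ?subr_ge0 ?(ltW rho1) ?(ltW r1)//.
    by rewrite lerB.
  rewrite normf_div (ger0_norm (exprn_ge0 _ (ltW p0))) ler_pM ?invr_ge0 ?exprn_ge0 ?(ltW p0)//.
  rewrite lef_pV2 ?posrE ?exprn_gt0 ?subr_gt0//.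
  by rewrite (exprM _ 2 2) lerXn2r ?nnegrE ?sqr_ge0// ltW.
have rr : r ^+ 2 < 1 := sqr_lt1 r1.
have rr0 := sqr_ge0 r.
have X8 : `|dhX r t| <= M.
  apply: norm_wmean_le => j; apply: bd.
  have := sin_max (2 * (al j - t)); set s := sin _ => s1.
  by rewrite ler_norml; move: s1; rewrite ler_norml => /andP[? ?]; apply/andP; split; nra.
have Y8 : `|dhY r t| <= M.
  apply: norm_wmean_le => j; apply: bd.
  have := cos_max (2 * (al j - t)); set s := cos _ => s1.
  move: (r1); rewrite ltr_norml => /andP[? ?].
  by rewrite ler_norml; move: s1; rewrite ler_norml => /andP[? ?]; apply/andP; split; nra.
have M0 : 0 <= M := le_trans (normr_ge0 _) X8.
have Q0 := hQ_gt0 t r1; have Yge := hY_ge t r1; have Y0 := hY_gt0 t r1.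
have rho2 : 0 < 1 - rho ^+ 2 by rewrite subr_gt0 sqr_lt1// ger0_norm.
have Yrho : (1 - rho ^+ 2) / 4 <= hY r t.
  apply: le_trans Yge; rewrite ler_pM2r ?invr_gt0// lerB//.
  by rewrite -(real_normK (num_real r)) lerXn2r ?nnegrE.
rewrite /dhU normf_div (gtr0_norm Q0) ler_pdivrMr//.
have -> : 64 / (1 - rho) ^+ 4 / (1 - rho ^+ 2) * hQ r t =
  M * (2 * (hQ r t / ((1 - rho ^+ 2) / 4))).
  by rewrite /M; field; rewrite gt_eqF//= gt_eqF// subr_gt0.
apply: (@le_trans _ _ (M * (hY r t + `|z - hX r t|))).
  apply: (le_trans (ler_normB _ _)); rewrite mulrDr lerD//.
    by rewrite normrM normrN (gtr0_norm Y0) ler_wpM2r// ltW.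
  by rewrite normrM mulrC ler_wpM2r.
(* It remains to compare (y + q) e with 2 (q ^ 2 + y ^ 2), where y = [hY], q = |z - hX| and e <= y:
   replace e by y. *)
rewrite ler_wpM2l// mulrA ler_pdivlMr ?divr_gt0//.
move: Yrho Y0; rewrite /hQ -(real_normK (num_real (z - hX r t))).
have := normr_ge0 (z - hX r t); set q := `|_|; set y := hY r t.
set e := (1 - rho ^+ 2) / 4 => q0 ey y0.
apply: (@le_trans _ _ ((y + q) * y)); first by rewrite ler_wpM2l// addr_ge0// ltW.
have := sqr_ge0 (y - q); have := sqr_ge0 q; have := sqr_ge0 y; nra.
Qed.

End harmonic.

(** * The mean of [hU] over circles *)

Section harmonic_mean.
Variables (R : realType) (m : nat) (al w : 'I_m -> R) (z : R).
Hypothesis w_ge0 : forall j, 0 <= w j.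
Hypothesis w_sum : \sum_(j < m) w j = 1.
Implicit Types r t : R.

Local Notation mu := (@lebesgue_measure R).
Local Notation hX := (hX al w).
Local Notation hY := (hY al w).
Local Notation dhX := (dhX al w).
Local Notation dhY := (dhY al w).
Local Notation hQ := (hQ al w z).
Local Notation hU := (hU al w z).
Local Notation dhU := (dhU al w z).

(** Continuity in the angle is read off from differentiability in [t]; the value of the derivative
    is left to unification. *)
Lemma continuous_dhX r : `|r| < 1 -> continuous (dhX r).
Proof.
move=> r1 t.
have H j := is_derive_scale (w j) (is_derive_div
  (g := fun t => pden (al j) r t ^+ 2)
  (expf_neq0 2 (lt0r_neq0 (pden_gt0 (al j) t r1)))
  (is_derive_mul (is_derive_scale 2 (is_derive_sin_angle (al j) t))
     (is_derive_cst (1 - r ^+ 2) t 1))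
  (is_derive_mul (is_derive_pden2 (al j) r t) (is_derive_pden2 (al j) r t))).
exact: is_derive_continuous (is_derive_bigsum H).
Qed.

Lemma continuous_dhY r : `|r| < 1 -> continuous (dhY r).
Proof.
move=> r1 t.
have H j := is_derive_scale (w j) (is_derive_div
  (g := fun t => pden (al j) r t ^+ 2)
  (expf_neq0 2 (lt0r_neq0 (pden_gt0 (al j) t r1)))
  (is_derive_scale (- 2) (is_derive_add (is_derive_cst (2 * r) t 1)
    (is_derive_mul (is_derive_cos_angle (al j) t)
     (is_derive_cst (1 + r ^+ 2) t 1))))
  (is_derive_mul (is_derive_pden2 (al j) r t) (is_derive_pden2 (al j) r t))).
exact: is_derive_continuous (is_derive_bigsum H).
Qed.

Lemma continuous_hX r : `|r| < 1 -> continuous (hX r).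
Proof.
by move=> r1 t; have := is_derive_hX2 al w t r1; exact: is_derive_continuous.
Qed.

Lemma continuous_hY r : `|r| < 1 -> continuous (hY r).
Proof.
by move=> r1 t; have := is_derive_hY2 al w t r1; exact: is_derive_continuous.
Qed.

Lemma continuous_hU r : `|r| < 1 -> continuous (hU r).
Proof.
move=> r1 t; apply: continuous_comp; last exact: continuous_atan.
apply: cvgM.
  by apply: cvgB; [exact: cvg_cst|exact: continuous_hX].
apply: cvgV; last exact: continuous_hY.
by rewrite lt0r_neq0// hY_gt0.
Qed.

Lemma continuous_dhU r : `|r| < 1 -> continuous (dhU r).
Proof.
move=> r1 t; have cY : hY r x @[x --> t] --> hY r t by exact: continuous_hY.
have czX : (fun t => z - hX r t) x @[x --> t] --> z - hX r t.
  by apply: cvgB; [exact: cvg_cst|exact: continuous_hX].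
apply: cvgM.
  apply: cvgB; apply: cvgM => //; last exact: continuous_dhY.
  by apply: cvgN; exact: continuous_dhX.
apply: cvgV; first by rewrite lt0r_neq0// hQ_gt0.
by apply: cvgD; apply: cvgM.
Qed.

Local Notation D := (`[(- (pi / 2)), (pi / 2)]%classic : set R).

Let pi2_lt : - (pi / 2) < pi / 2 :> R.
Proof. by have := pi_gt0 R; lra. Qed.

Lemma integrable_D (f : R -> R) : continuous f -> mu.-integrable D (EFin \o f).
Proof.
move=> cf; apply: continuous_compact_integrable; first exact: segment_compact.
exact: continuous_subspaceT.
Qed.

Lemma Rintegral_dhU r : `|r| < 1 -> r != 0 ->
  (\int[mu]_(t in D) dhU r t)%R = 0.
Proof.
move=> r1 r0.
(* The endpoints of [D] differ by pi, which changes the doubled angles by a full turn. *)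
have per : hQ r (pi / 2) = hQ r (- (pi / 2)).
  have e j : 2 * (al j - - (pi / 2)) = 2 * (al j - pi / 2) + pi *+ 2 by field.
  by rewrite /hQ /hX /hY; congr ((z - _) ^+ 2 + _ ^+ 2); apply: eq_bigr => j _;
    rewrite /px /py /pden e ?sinD2pi cosD2pi.
have FTC : (\int[mu]_(t in D) (4 * r * dhU r t)%:E = 0)%E.
  rewrite (@continuous_FTC2 _ _ (fun t => ln (hQ r t)))//.
  - by rewrite per subee.
  - apply: continuous_subspaceT => t.
    by apply: cvgM; [exact: cvg_cst|exact: continuous_dhU].
  - have c t : {for t, continuous (fun t => ln (hQ r t))}.
      exact: is_derive_continuous (is_derive_lnQ2 al z w_ge0 w_sum t r1).
    split.
    + by move=> t _; have [] := is_derive_lnQ2 al z w_ge0 w_sum t r1.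
    + by apply: cvg_at_right_filter; exact: c.
    + by apply: cvg_at_left_filter; exact: c.
  - move=> t _; rewrite derive1E.
    by have [] := is_derive_lnQ2 al z w_ge0 w_sum t r1.
have : (\int[mu]_(t in D) (4 * r * dhU r t))%R = 0.
  by rewrite /Rintegral FTC.
rewrite RintegralZl//; last by apply: integrable_D; exact: continuous_dhU.
move/eqP; rewrite !mulf_eq0 (negbTE r0) orbF => /orP[|/eqP//].
by rewrite pnatr_eq0.
Qed.

Lemma is_derive_Rintegral_hU r : `|r| < 1 ->
  is_derive r 1 (fun r => \int[mu]_(t in D) hU r t)%R
    (\int[mu]_(t in D) dhU r t)%R.
Proof.
(* [rho] is the midpoint of |r| and 1, so [r] is interior to an interval on which the domination is
   uniform. *)
move=> r1; pose rho := (1 + `|r|) / 2.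
have r0 := normr_ge0 r.
have rho1 : rho < 1 by rewrite /rho; lra.
have rrho : `|r| < rho by rewrite /rho; lra.
have Irho x : `](- rho), rho[%classic x -> `|x| < rho.
  by rewrite /= in_itv/= -ltr_norml.
have Ir : `](- rho), rho[%classic r by rewrite /= in_itv/= -ltr_norml.
set G := 64 / (1 - rho) ^+ 4 / (1 - rho ^+ 2).
have dE x t : `|x| < 1 -> partial1of2 hU x t = dhU x t.
  move=> x1; rewrite partial1of2E.
  by have [] := is_derive_hU1 al z w_ge0 w_sum t x1.
have G0 : 0 <= G.
  by apply: le_trans (norm_dhU_le al z w_ge0 w_sum 0 (ltW rrho) rho1).
have intf x : `](- rho), rho[%classic x -> mu.-integrable D (EFin \o hU x).
  move=> /Irho xr; apply: integrable_D; apply: continuous_hU.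
  exact: lt_trans xr rho1.
have derf x t : `](- rho), rho[%classic x -> D t -> derivable (hU ^~ t) x 1.
  move=> /Irho xr _.
  by have [] := is_derive_hU1 al z w_ge0 w_sum t (lt_trans xr rho1).
have intG : mu.-integrable D (EFin \o cst G).
  by apply: integrable_D; exact: cst_continuous.
have Gub x t : `](- rho), rho[%classic x -> D t ->
    `|partial1of2 hU x t| <= cst G t.
  move=> /Irho xr _; rewrite dE; last exact: lt_trans xr rho1.
  by apply: norm_dhU_le => //; exact: ltW.
have mD : measurable (D : set (measurableTypeR R)) by [].
split.
  exact: (@derivable_under_integral R _ (measurableTypeR R) mu hU D mD r _ _ Ir
    intf derf (cst G) (fun=> G0) intG Gub).
rewrite -derive1E (@differentiation_under_integral R _ (measurableTypeR R) mu hU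
  D mD r _ _ Ir intf derf (cst G) (fun=> G0) intG Gub).
by apply: eq_Rintegral => t _; exact: dE.
Qed.

(** The derivative of the integral vanishes on ]0, r[, so the mean value theorem brings the radius
    down to 0. There [hX] is 0, [hY] is 1 and [hU] is constantly atan z; the factor pi is the length
    of [D]. *)
Lemma Rintegral_hU r : 0 <= r < 1 ->
  (\int[mu]_(t in D) hU r t)%R = pi * atan z.
Proof.
move=> /andP[r0 r1].
have lt1 x : x \in `[0, r]%R -> `|x| < 1.
  by rewrite in_itv/= => /andP[x0 xr]; rewrite ger0_norm// (le_lt_trans xr).
have -> : (\int[mu]_(t in D) hU r t)%R = (\int[mu]_(t in D) hU 0 t)%R.
  move: r0; rewrite le_eqVlt => /predU1P[<-//|r0].
  have dI x : x \in `]0, r[%R -> is_derive x 1 (fun r => \int[mu]_(t in D) hU r t)%R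
      (\int[mu]_(t in D) dhU x t)%R.
    by move=> xr; apply/is_derive_Rintegral_hU/lt1/subset_itv_oo_cc.
  have [|c c0r] := MVT r0 dI.
    apply: derivable_within_continuous => x xr.
    by have [] := is_derive_Rintegral_hU (lt1 _ xr).
  rewrite Rintegral_dhU ?mul0r; first by move/eqP; rewrite subr_eq0 => /eqP.
    by apply: lt1; exact: subset_itv_oo_cc.
  by move: c0r; rewrite in_itv/= => /andP[c0 _]; rewrite gt_eqF.
have hU0 t : hU 0 t = atan z.
  rewrite /hU; congr atan; rewrite /hX /hY.
  rewrite big1 => [|j _]; last by rewrite /px mulr0 !mul0r mulr0.
  under eq_bigr do rewrite /py /pden mulr0 mul0r expr0n addr0 subr0 addr0 divr1 mulr1.
  by rewrite w_sum subr0 divr1.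
transitivity (\int[mu]_(t in D) (cst (atan z) t))%R.
  by apply: eq_Rintegral => t _; exact: hU0.
rewrite Rintegral_cst//= lebesgue_measure_itv/= lte_fin pi2_lt mulrC.
by rewrite -EFinB/=; congr (_ * _); field.
Qed.

End harmonic_mean.

(** * Boundary values *)

(** Inversion is continuous off 0, and {0} is a measurable singleton. *)
Lemma measurable_fun_inv (R : realType) (d : measure_display)
    (T : measurableType d) (f : T -> R) :
  measurable_fun setT f -> measurable_fun setT (fun x => (f x)^-1).
Proof.
move=> mf; apply: (measurableT_comp (f := @GRing.inv R)) mf.
have -> : [set: R] = [set 0] `|` ~` [set 0] by rewrite setUv.
apply/measurable_funU => //; first exact: measurableC.
split; first exact: measurable_fun_set1.
apply: open_continuous_measurable_fun.
  by rewrite openC; exact: closed_eq.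
move=> x; rewrite inE/= => /eqP x0; exact: inv_continuous.
Qed.

Section boundary_value.
Variable R : realType.
Implicit Types a t : R.

Local Notation mu := (@lebesgue_measure R).
Local Notation O := (`](- (pi / 2)), (pi / 2)[%classic : set R).
Local Notation D := (`[(- (pi / 2)), (pi / 2)]%classic : set R).

Let pi2_lt : - (pi / 2) < pi / 2 :> R.
Proof. by have := pi_gt0 R; lra. Qed.

Lemma pden1 a t : pden a 1 t = 4 * cos (a - t) ^+ 2.
Proof.
by rewrite /pden [2 * (a - t)]mulr_natl cos_mulr2n; ring.
Qed.

Lemma px1 a t : cos (a - t) != 0 -> px a 1 t = tan (a - t).
Proof.
move=> c0; rewrite /px pden1 [2 * (a - t)]mulr_natl sin_mulr2n /tan.
by field.
Qed.

Lemma measurable_fun_sum_tan (m : nat) (al w : 'I_m -> R) :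
  measurable_fun setT (fun t => \sum_(j < m) w j * tan (al j - t)).
Proof.
apply: measurable_sum => j; apply: measurable_funM => //.
have ms : measurable_fun setT (fun t => al j - t) by exact: measurable_funB.
apply: measurable_funM.
  apply: measurableT_comp ms; apply: continuous_measurable_fun.
  exact: continuous_sin.
apply: measurable_fun_inv; apply: measurableT_comp ms.
by apply: continuous_measurable_fun; exact: continuous_cos.
Qed.

Section fixed_angles.
Variables (m : nat) (al w : 'I_m -> R).
Hypothesis al_itv : forall j, O (al j).
Hypothesis w_ge0 : forall j, 0 <= w j.
Hypothesis w_sum : \sum_(j < m) w j = 1.

Let phi t := \sum_(j < m) w j * tan (al j - t).

Lemma ae_cos_neq0 : {ae mu, forall t, O t -> forall j, cos (al j - t) != 0}.
Proof.
have : {ae mu, forall t, forall j, O t -> cos (al j - t) != 0}.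
  apply: filter_forall => j.
  (* In [O], cos (a_j - t) = 0 means tan t = - cot a_j, which has a single solution; if sin a_j = 0
     there is none, because both cosines are positive. *)
  exists [set atan (- cos (al j) / sin (al j))]; split => //.
    exact: lebesgue_measure_set1.
  move=> t /= /not_implyP[Ot /negP]; rewrite negbK cosB => /eqP H.
  have ca : 0 < cos (al j) by apply: cos_gt0_pihalf; have := al_itv j; rewrite /= in_itv.
  have ct : 0 < cos t by apply: cos_gt0_pihalf; move: Ot; rewrite /= in_itv.
  have sa : sin (al j) != 0.
    apply/eqP => s0; move: H; rewrite s0 mul0r addr0 => /eqP.
    by rewrite mulf_eq0 !gt_eqF.
  rewrite -[t in t = _]tanK; last by move: Ot; rewrite /= !in_itv.
  congr atan; apply: (mulIf sa); rewrite divfK// /tan.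
  apply: (mulIf (lt0r_neq0 ct)).
  rewrite mulrAC divfK ?lt0r_neq0// mulNr; apply/eqP.
  by rewrite -subr_eq0 opprK mulrC addrC; apply/eqP.
by apply: filterS; [exact: (ae_filter_ringOfSetsType mu)|move=> t H Ot j; exact: H].
Qed.

(** Radii in [0, 1[ tending to 1, taken as a sequence in view of dominated convergence. *)
Let r_ n : R := 1 - n.+1%:R^-1.

Let r_itv n : 0 <= r_ n < 1.
Proof.
rewrite /r_ subr_ge0 invf_le1 ?ltr0n// ler1n/=.
by rewrite ltrBlDr ltrDl invr_gt0 ltr0n.
Qed.

Let r_lt1 n : `|r_ n| < 1.
Proof. by have /andP[r0 r1] := r_itv n; rewrite ger0_norm. Qed.

Let cvg_r : r_ n @[n --> \oo] --> (1 : R).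
Proof.
rewrite -[X in _ --> X]subr0; apply: cvgB; first exact: cvg_cst.
exact: cvg_harmonic.
Qed.

(** As r tends to 1, [hX] tends to phi t < z while [hY] tends to 0 from above, so the quotient
    inside atan tends to +oo. *)
Lemma cvg_hU z t : (forall j, cos (al j - t) != 0) -> phi t < z ->
  hU al w z (r_ n) t @[n --> \oo] --> pi / 2.
Proof.
move=> c0 phiz.
have p0 j : pden (al j) 1 t != 0 by rewrite pden1 mulf_neq0 ?expf_neq0.
have cX : hX al w (r_ n) t @[n --> \oo] --> phi t.
  have -> : phi t = hX al w 1 t by apply: eq_bigr => j _; rewrite px1.
  have c : {for 1, continuous (fun r => hX al w r t)}.
    exact: is_derive_continuous (is_derive_bigsum
      (fun j => is_derive_scale (w j) (is_derive_px1 (p0 j)))).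
  exact: (cvg_comp _ _ cvg_r c).
have cY : hY al w (r_ n) t @[n --> \oo] --> (0 : R).
  have <- : hY al w 1 t = 0.
    by rewrite /hY big1// => j _; rewrite /py expr1n subrr mul0r mulr0.
  have c : {for 1, continuous (fun r => hY al w r t)}.
    exact: is_derive_continuous (is_derive_bigsum
      (fun j => is_derive_scale (w j) (is_derive_py1 (p0 j)))).
  exact: (cvg_comp _ _ cvg_r c).
apply: (@cvg_comp _ _ _ (fun n => (z - hX al w (r_ n) t) / hY al w (r_ n) t) atan
  _ _ _ _ (@cvgy_atan R)).
(* The quotient is at least [A] once numerator minus [A] times denominator is nonnegative, and that
   difference has the positive limit z - phi t. *)
apply/cvgryPge => A.
have : (z - hX al w (r_ n) t) - A * hY al w (r_ n) t @[n --> \oo] -->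
    (z - phi t) - A * 0.
  apply: cvgB; first by apply: cvgB => //; exact: cvg_cst.
  by apply: cvgM => //; exact: cvg_cst.
move=> /cvgr_gt /(_ 0); rewrite mulr0 subr0 subr_gt0 => /(_ phiz).
apply: filterS => n; rewrite subr_gt0 => /ltW H.
by rewrite ler_pdivlMr// hY_gt0.
Qed.

Lemma measurable_phi_lt z : measurable (O `&` [set t | phi t < z]).
Proof.
apply: measurableI => //.
rewrite (_ : [set t | _] = phi @^-1` `]-oo, z[%classic); last first.
  by apply/seteqP; split => t /=; rewrite in_itv.
by rewrite -[X in measurable X]setTI; apply: measurable_fun_sum_tan.
Qed.

Lemma measurable_phi_le z : measurable (O `&` [set t | phi t <= z]).
Proof.
apply: measurableI => //.
rewrite (_ : [set t | _] = phi @^-1` `]-oo, z]%classic); last first.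
  by apply/seteqP; split => t /=; rewrite in_itv.
by rewrite -[X in measurable X]setTI; apply: measurable_fun_sum_tan.
Qed.

(** The functions hU + pi / 2 lie between 0 and pi, have integral pi (pi / 2 + atan z) over [D] at
    every radius, and tend to pi almost everywhere on [E]. Dominated convergence on [E] bounds pi
    times the measure of [E] by that integral. *)
Lemma lebesgue_phi_lt z :
  (mu (O `&` [set t | (phi t < z)%R]) <= (pi / 2 + atan z)%:E)%E.
Proof.
set E := _ `&` _; have mE : measurable E := measurable_phi_lt z.
have ED : E `<=` D by move=> t [Ot _]; exact: subset_itv_oo_cc.
pose f n t := (hU al w z (r_ n) t + pi / 2)%:E.
have f_ge0 n t : (0 <= f n t)%E.
  by rewrite lee_fin -lerBlDr sub0r ltW// atan_gtNpi2.
have cU n : continuous (hU al w z (r_ n)) by move=> t; exact: continuous_hU.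
have mf n : measurable_fun setT (f n).
  apply/measurable_EFinP; apply: measurable_funD => //.
  by apply: continuous_measurable_fun.
have f_le n t : (`|f n t| <= (cst pi t)%:E)%E.
  rewrite gee0_abs// lee_fin /=; have := atan_ltpi2 ((z - hX al w (r_ n) t) / hY al w (r_ n) t).
  by rewrite /hU; set u := atan _; lra.
have intf n : (\int[mu]_(t in D) f n t = (pi * (pi / 2 + atan z))%:E)%E.
  have iU : mu.-integrable D (EFin \o hU al w z (r_ n)).
    exact: integrable_D.
  have ic : mu.-integrable D (EFin \o cst (pi / 2 : R)).
    by apply: integrable_D; exact: cst_continuous.
  have HR := Rintegral_hU al z w_ge0 w_sum (r_itv n).
  rewrite /f; under eq_integral do rewrite EFinD.
  rewrite integralD// integral_cst//= lebesgue_measure_itv/= lte_fin pi2_lt.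
  rewrite -[X in (X + _ = _)%E]fineK; last exact: integrable_fin_num.
  move: HR; rewrite /Rintegral/= => ->.
  by rewrite -EFinB -EFinM -EFinD; congr (_%:E); field.
have aeE : {ae mu, forall t, E t -> f n t @[n --> \oo] --> (pi : R)%:E}.
  have := ae_cos_neq0; apply: filterS; first exact: (ae_filter_ringOfSetsType mu).
  move=> t H [Ot phit].
  apply: cvg_EFin; first exact: nearW.
  rewrite (_ : pi = pi / 2 + pi / 2 :> R); last by field.
  apply: cvgD; last exact: cvg_cst.
  by apply: cvg_hU => //; exact: H.
have ipi : mu.-integrable E (EFin \o cst (pi : R)).
  apply: (@integrableS _ (measurableTypeR R) R mu D E _ _ mE ED) => //.
  by apply: integrable_D; exact: cst_continuous.
have mfE n : measurable_fun (E : set (measurableTypeR R)) (f n).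
  by apply: (@measurable_funTS _ _ (measurableTypeR R)); exact: mf.
have aeb : {ae mu, forall t n, E t -> (`|f n t| <= (EFin \o cst (pi : R)) t)%E}.
  by apply: aeW => t n _; exact: f_le.
have [_ _ cv] := @dominated_convergence _ (measurableTypeR R) R mu E mE f
  (cst (pi : R)%:E) (EFin \o cst (pi : R)) mfE (measurable_cst _) aeE ipi
  aeb.
have : (\int[mu]_(t in E) (pi : R)%:E <= (pi * (pi / 2 + atan z))%:E)%E.
  apply: (cvge_le _ cv); apply: nearW => n; rewrite -(intf n).
  apply: ge0_subset_integral => //.
  by apply: (@measurable_funTS _ _ (measurableTypeR R)); exact: mf.
rewrite integral_cst// EFinM lee_pmul2l//.
by rewrite lte_fin pi_gt0.
Qed.

(** Compare with phi < z' for z' > z and let z' decrease to z, by continuity of atan. *)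
Lemma lebesgue_phi_le_ub z :
  (mu (O `&` [set t | (phi t <= z)%R]) <= (pi / 2 + atan z)%:E)%E.
Proof.
have H z' : z < z' ->
    (mu (O `&` [set t | (phi t <= z)%R]) <= (pi / 2 + atan z')%:E)%E.
  move=> zz'; apply: le_trans (lebesgue_phi_lt z'); apply: le_measure.
  - by rewrite inE; exact: measurable_phi_le.
  - by rewrite inE; exact: measurable_phi_lt.
  - by apply: setIS => t /= /le_lt_trans; exact.
apply/lee_addgt0Pr => e e0.
have c : atan x @[x --> z^'+] --> atan z.
  by apply: cvg_at_right_filter; exact: continuous_atan.
have near_lt : \forall x \near z^'+, atan x < atan z + e.
  by move/cvgr_lt: c; apply; rewrite ltrDl.
near z^'+ => z'.
apply: (le_trans (H z' _)); first by [].
rewrite -EFinD lee_fin -addrA lerD2l ltW//.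
by near: z'.
Unshelve. all: by end_near. Qed.

End fixed_angles.

Section tan_law.
Variables (m : nat) (al w : 'I_m -> R) (z : R).
Hypothesis al_itv : forall j, O (al j).
Hypothesis w_ge0 : forall j, 0 <= w j.
Hypothesis w_sum : \sum_(j < m) w j = 1.

Let phi t := \sum_(j < m) w j * tan (al j - t).

(** Reflection: changing the signs of the angles, of [t] and of [z] turns phi t > z into the case
    already bounded, and atan is odd. *)
Lemma lebesgue_sum_tan_gt :
  (mu (O `&` [set t | (z < phi t)%R]) <= (pi / 2 - atan z)%:E)%E.
Proof.
have alN j : O (- al j) by have := al_itv j; rewrite /= !in_itv/= ltrN2 ltrNl andbC.
have := lebesgue_phi_lt alN w_ge0 w_sum (- z).
rewrite atanN -[X in (X <= _)%E]lebesgue_measureN; last exact: measurable_phi_lt.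
apply: le_trans; rewrite le_eqVlt; apply/orP; left; apply/eqP; congr (mu _).
apply/seteqP; split => t /=; rewrite !in_itv/= ltrN2 (ltrNl _ (pi / 2)) (andbC (_ < pi / 2));
  move=> -[-> H]; split=> //; move: H; rewrite /phi.
all: under eq_bigr do rewrite -opprD tanN mulrN.
all: rewrite sumrN ltrN2.
all: by under eq_bigr do rewrite addrC.
Qed.

(** The upper bounds for the two complementary sets add up to pi, the measure of [O], so both are
    equalities. *)
Lemma lebesgue_sum_tan_le :
  (mu (O `&` [set t | (phi t <= z)%R]) = (pi / 2 + atan z)%:E)%E.
Proof.
have ub := lebesgue_phi_le_ub al_itv w_ge0 w_sum z.
have lb := lebesgue_sum_tan_gt.
have mle : measurable (O `&` [set t | (phi t <= z)%R]) by exact: measurable_phi_le.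
have E : O `&` [set t | (z < phi t)%R] = O `\` (O `&` [set t | (phi t <= z)%R]).
  apply/seteqP; split => t /=.
    by move=> [Ot zt]; split => //; rewrite leNgt => -[_]; rewrite zt.
  by move=> [Ot H]; split => //; rewrite ltNge; apply/negP => ?; exact: H.
have muO : (mu O = (pi : R)%:E)%E.
  by rewrite lebesgue_measure_itv/= lte_fin pi2_lt -EFinB; congr (_%:E); field.
have muD : (mu (O `\` (O `&` [set t | (phi t <= z)%R])) =
    mu O - mu (O `&` (O `&` [set t | (phi t <= z)%R])))%E.
  by apply: measureD => //; rewrite [X in (X < _)%E]muO ltry.
move: lb; rewrite E muD muO setIA setIid.
have fle : mu (O `&` [set t | (phi t <= z)%R]) \is a fin_num.
  by rewrite ge0_fin_numE// (le_lt_trans ub) ?ltry.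
rewrite -(fineK fle) -EFinB lee_fin => lb.
move: ub; rewrite -{1}(fineK fle) lee_fin => ub.
congr (_%:E); apply/eqP; rewrite eq_le ub/=.
by move: lb; set x := fine _; lra.
Qed.

End tan_law.
End boundary_value.

(** * The Cauchy distribution *)

Section cauchy_law.
Variable R : realType.
Local Notation mu := (@lebesgue_measure R).

Lemma oneDsqr_gt0 (x : R) : 0 < 1 + x ^+ 2.
Proof. by rewrite ltr_wpDr// sqr_ge0. Qed.

Lemma cauchy_pdf_ge0 (x : R) : 0 <= cauchy_pdf x.
Proof. by rewrite /cauchy_pdf invr_ge0 mulr_ge0 ?pi_ge0// ltW// oneDsqr_gt0. Qed.

Lemma continuous_cauchy_pdf : continuous (@cauchy_pdf R).
Proof.
move=> x; apply: cvgV.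
  by rewrite mulf_neq0 ?gt_eqF ?pi_gt0// oneDsqr_gt0.
apply: cvgM; first exact: cvg_cst.
by apply: cvgD; [exact: cvg_cst|exact: exprn_continuous].
Qed.

Lemma measurable_cauchy_pdf :
  measurable_fun (setT : set (measurableTypeR R)) (EFin \o @cauchy_pdf R).
Proof.
apply/measurable_EFinP; apply: continuous_measurable_fun.
exact: continuous_cauchy_pdf.
Qed.

(** The Cauchy law as a set function; the measure structure given to it below makes uniqueness of
    measures applicable. *)
Definition cauchy_prob (V : set (measurableTypeR R)) : \bar R :=
  (\int[mu]_(x in V) (cauchy_pdf x)%:E)%E.

Let cauchy_prob0 : cauchy_prob set0 = 0%E.
Proof. by rewrite /cauchy_prob integral_set0. Qed.

Let cauchy_prob_ge0 V : (0 <= cauchy_prob V)%E.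
Proof. by apply: integral_ge0 => x _; rewrite lee_fin cauchy_pdf_ge0. Qed.

Let cauchy_prob_sigma_additive : semi_sigma_additive cauchy_prob.
Proof.
move=> /= F mF tF mUF; rewrite /cauchy_prob; apply: cvg_toP.
  apply: ereal_nondecreasing_is_cvgn => m n mn.
  apply: lee_sum_nneg_natr => // k _ _; apply: integral_ge0 => /= x Fkx.
  by rewrite lee_fin cauchy_pdf_ge0.
rewrite ge0_integral_bigcup//=.
- by apply: measurable_funTS; exact: measurable_cauchy_pdf.
- by move=> x _; rewrite lee_fin cauchy_pdf_ge0.
Qed.

HB.instance Definition _ := isMeasure.Build _ _ _ cauchy_prob
  cauchy_prob0 cauchy_prob_ge0 cauchy_prob_sigma_additive.

Lemma cauchy_prob_itvoc (a b : R) : a < b ->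
  cauchy_prob `]a, b]%classic = ((atan b - atan a) / pi)%:E.
Proof.
move=> ab.
have -> : cauchy_prob `]a, b]%classic = cauchy_prob `[a, b]%classic.
  rewrite /cauchy_prob integral_itv_obnd_cbnd//.
  by apply: measurable_funTS; exact: measurable_cauchy_pdf.
have dF (x : R) : is_derive x 1 (fun x : R => pi^-1 * atan x) (cauchy_pdf x).
  apply: (is_derive_congr (is_derive_scale pi^-1 (is_derive1_atan x))).
  by rewrite /cauchy_pdf invfM.
have cF x : {for x, continuous (fun x : R => pi^-1 * atan x)}.
  exact: is_derive_continuous (dF x).
rewrite /cauchy_prob (@continuous_FTC2 _ _ (fun x => pi^-1 * atan x))//.
- by rewrite -EFinB -mulrBr mulrC.
- by apply: continuous_subspaceT; exact: continuous_cauchy_pdf.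
- split.
  + by move=> x _; have [] := dF x.
  + by apply: cvg_at_right_filter; exact: cF.
  + by apply: cvg_at_left_filter; exact: cF.
- by move=> x _; rewrite derive1E; have [] := dF x.
Qed.

(** Differences of the distribution function show that the law of [Z] and the Cauchy law agree on
    half-open intervals, a generating family stable under intersection. *)
Lemma is_std_cauchy_cdf (d : measure_display) (T : measurableType d)
    (P : probability T R) (Z : T -> R) : measurable_fun setT Z ->
  (forall z, P (Z @^-1` `]-oo, z]%classic) = (2^-1 + atan z / pi)%:E) ->
  is_std_cauchy P Z.
Proof.
move=> mZ cdf B mB.
have mpre V : measurable (V : set R) -> measurable (Z @^-1` V).
  by move=> mV; rewrite -[X in measurable X]setTI; exact: mZ.
have Poc a b : a < b -> P (Z @^-1` `]a, b]%classic) = ((atan b - atan a) / pi)%:E.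
  move=> ab.
  have -> : Z @^-1` `]a, b]%classic =
      Z @^-1` `]-oo, b]%classic `\` Z @^-1` `]-oo, a]%classic.
    apply/seteqP; split => t /=; rewrite !in_itv/=.
      by move=> /andP[h1 h2]; split => //; apply/negP; rewrite -ltNge.
    by move=> [h1 /negP]; rewrite -ltNge => ->.
  have -> : P (Z @^-1` `]-oo, b]%classic `\` Z @^-1` `]-oo, a]%classic) =
      (P (Z @^-1` `]-oo, b]%classic) -
       P (Z @^-1` `]-oo, b]%classic `&` Z @^-1` `]-oo, a]%classic))%E.
    apply: measureD; [exact: mpre|exact: mpre|].
    by rewrite (le_lt_trans (probability_le1 _ _)) ?ltry//; exact: mpre.
  rewrite setIidr; last first.
    by move=> t /=; rewrite !in_itv/= => /le_trans; apply; exact: ltW.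
  by rewrite !cdf -EFinB; congr (_%:E); ring.
rewrite -/(cauchy_prob B).
pose g (k : nat) : set (measurableTypeR R) := `](- k%:R), k%:R]%classic.
have mZ' : measurable_fun setT (Z : T -> measurableTypeR R) by [].
pose m1 := measure_function_pushforward__canonical__measure_function_Measure P mZ'.
rewrite -[LHS]/(m1 B).
apply: (@measure_unique _ R (measurableTypeR R) (@ocitv R) g) => //.
- exact: ocitvI.
- by move=> k; exact: is_ocitv.
(* The index floor |x| + 1 makes the bound on |x| strict, as the open left end of [g k] requires. *)
- apply/seteqP; split => // x _; exists (Num.truncn `|x|).+1 => //.
  rewrite /g/= in_itv/=; have := truncnS_gt `|x|.
  by rewrite ltr_norml => /andP[-> /ltW ->].
- move=> _ [[a b] _ <-] /=.
  have [ab|ba] := ltP a b; last by rewrite set_itv_ge ?bnd_simp -?leNgt// !measure0.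
  by rewrite cauchy_prob_itvoc// -Poc.
- move=> k; apply: (@le_lt_trans _ _ 1%E); last exact: ltry.
  by apply: probability_le1; apply: mpre; exact: measurable_itv.
Qed.

End cauchy_law.

(** * Rotation invariant densities *)

Section rotated_density.
Variables (R : realType) (m : nat).
Implicit Types (c s t : R) (v : (m + m).-tuple R).

Definition tuple_lo v : m.-tuple R := [tuple tnth v (lshift m j) | j < m].
Definition tuple_hi v : m.-tuple R := [tuple tnth v (rshift m j) | j < m].

Definition tuple_rot c s v : (m + m).-tuple R :=
  cat_tuple (tuple_comb c (- s) (tuple_lo v) (tuple_hi v))
            (tuple_comb s c (tuple_lo v) (tuple_hi v)).

Lemma tuple_lo_cat (x y : m.-tuple R) : tuple_lo (cat_tuple x y) = x.
Proof. by apply: eq_from_tnth => j; rewrite tnth_mktuple tnth_lshift. Qed.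

Lemma tuple_hi_cat (x y : m.-tuple R) : tuple_hi (cat_tuple x y) = y.
Proof. by apply: eq_from_tnth => j; rewrite tnth_mktuple tnth_rshift. Qed.

Lemma iint_tuple_rot c s (f : (m + m).-tuple R -> \bar R) :
  c ^+ 2 + s ^+ 2 = 1 -> 1 + c != 0 ->
  measurable_fun setT f -> (forall z, 0 <= f z)%E ->
  iint (fun v => f (tuple_rot c s v)) = iint f.
Proof.
move=> cs c1 mf f0; rewrite !iint_cat.
rewrite -[RHS](@iint_rotation _ _ c s (fun xy => f (cat_tuple xy.1 xy.2)))//.
  apply: eq_iint => x; apply: eq_iint => y.
  by rewrite /tuple_rot tuple_lo_cat tuple_hi_cat.
by apply: (measurableT_comp mf); exact: measurable_fun_cat_tuple.
Qed.

Lemma row_of_tupleE v :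
  row_of_tuple v = row_mx (row_of_tuple (tuple_lo v)) (row_of_tuple (tuple_hi v)).
Proof.
apply/rowP => i; rewrite mxE.
case: (split_ordP i) => j ->.
  by rewrite row_mxEl mxE tnth_mktuple.
by rewrite row_mxEr mxE tnth_mktuple.
Qed.

Lemma row_of_tuple_comb (a b : R) (x y : m.-tuple R) :
  row_of_tuple (tuple_comb a b x y) = a *: row_of_tuple x + b *: row_of_tuple y.
Proof. by apply/rowP => i; rewrite !mxE tnth_mktuple. Qed.

Lemma qform_block (A B : 'M[R]_m) (x y : 'rV[R]_m) :
  qform (blockF A B) (row_mx x y) =
  (x *m A *m x^T) 0 0 - (y *m B *m x^T) 0 0 + (x *m B *m y^T) 0 0
  + (y *m A *m y^T) 0 0.
Proof.
rewrite /qform /blockF mul_row_block tr_row_mx mul_row_col !mulmxDl mulmxN mulNmx.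
by rewrite !mxE addrA.
Qed.

(* [blockF A B] commutes with the complex structure (x, y) |-> (-y, x). *)
Lemma qform_rot (A B : 'M[R]_m) c s v : c ^+ 2 + s ^+ 2 = 1 ->
  qform (blockF A B) (row_of_tuple (tuple_rot c s v)) =
  qform (blockF A B) (row_of_tuple v).
Proof.
move=> cs; rewrite !row_of_tupleE /tuple_rot tuple_lo_cat tuple_hi_cat.
rewrite !row_of_tuple_comb; set x := row_of_tuple _; set y := row_of_tuple _.
rewrite !qform_block.
have bil (M : 'M[R]_m) (a b a' b' : R) :
    ((a *: x + b *: y) *m M *m (a' *: x + b' *: y)^T) 0 0 =
    a * a' * (x *m M *m x^T) 0 0 + a * b' * (x *m M *m y^T) 0 0
    + b * a' * (y *m M *m x^T) 0 0 + b * b' * (y *m M *m y^T) 0 0.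
  rewrite [(_ + _)^T]linearD/= ![(_ *: _)^T]linearZ/= !(mulmxDl, mulmxDr) -!(scalemxAl, scalemxAr).
  rewrite !mxE; ring.
rewrite !bil.
set xax := (x *m A *m x^T) 0 0; set xay := (x *m A *m y^T) 0 0.
set yax := (y *m A *m x^T) 0 0; set yay := (y *m A *m y^T) 0 0.
set xbx := (x *m B *m x^T) 0 0; set xby := (x *m B *m y^T) 0 0.
set ybx := (y *m B *m x^T) 0 0; set yby := (y *m B *m y^T) 0 0.
(* The terms in [xay], [yax], [xbx] and [yby] occur with both c s and - c s, and cancel. *)
transitivity ((c ^+ 2 + s ^+ 2) * (xax - ybx + xby + yay)); first by ring.
by rewrite cs mul1r.
Qed.

Lemma measurable_fun_tuple_rot (d : measure_display) (T : measurableType d)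
    (c s : T -> R) (f : T -> (m + m).-tuple R) :
  measurable_fun setT c -> measurable_fun setT s -> measurable_fun setT f ->
  measurable_fun setT (fun a => tuple_rot (c a) (s a) (f a)).
Proof.
move=> mc ms mf.
have mlo j : measurable_fun setT (fun a => tnth (tuple_lo (f a)) j).
  rewrite (_ : (fun a => _) = (fun a => tnth (f a) (lshift m j))).
    exact: measurable_fun_tnth.
  by apply/funext => a; rewrite tnth_mktuple.
have mhi j : measurable_fun setT (fun a => tnth (tuple_hi (f a)) j).
  rewrite (_ : (fun a => _) = (fun a => tnth (f a) (rshift m j))).
    exact: measurable_fun_tnth.
  by apply/funext => a; rewrite tnth_mktuple.
apply: measurable_fun_cat_tuple; apply: measurable_fun_mktuple => j;
  apply: measurable_funD; apply: measurable_funM => //.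
exact: measurableT_comp ms.
Qed.

(** Polar form with the signed radius k = y / cos a: x = k sin a and y = k cos a, so the addition
    formulas apply and k cancels. *)
Lemma ratio_rot (x y t : R) : y != 0 ->
  (cos t * x + - sin t * y) / (sin t * x + cos t * y) = tan (atan (x / y) - t).
Proof.
move=> y0; set a := atan (x / y).
have ca : cos a != 0.
  by rewrite gt_eqF// cos_gt0_pihalf// atan_gtNpi2 atan_ltpi2.
have k0 : y / cos a != 0 by rewrite mulf_neq0 ?invr_eq0.
have xE : x = y / cos a * sin a.
  have := atanK (x / y); rewrite -/a /tan => H.
  by rewrite -mulrA [_^-1 * _]mulrC H mulrC divfK.
have yE : y = y / cos a * cos a by rewrite divfK.
have -> : cos t * x + - sin t * y = y / cos a * sin (a - t).
  by rewrite {1}xE {2}yE sinB; ring.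
have -> : sin t * x + cos t * y = y / cos a * cos (a - t).
  by rewrite {1}xE {2}yE cosB; ring.
by rewrite -mulf_div divff// mul1r.
Qed.

End rotated_density.

(** * Averaging over the angle of rotation *)

Section ratio_average.
Variables (R : realType) (m : nat) (w : 'I_m -> R) (z : R).
Hypothesis w_ge0 : forall j, 0 <= w j.
Hypothesis w_sum : \sum_(j < m) w j = 1.

Local Notation mu := (@lebesgue_measure R).
Local Notation O := (`](- (pi / 2)), (pi / 2)[%classic : set R).

Definition ratio_mean (v : (m + m).-tuple R) : R :=
  \sum_(j < m) w j * (tnth v (lshift m j) / tnth v (rshift m j)).

Definition ratio_set : set ((m + m).-tuple R) := [set v | ratio_mean v <= z].

Lemma measurable_fun_ratio_mean : measurable_fun setT ratio_mean.
Proof.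
apply: measurable_sum => j; apply: measurable_funM => //.
apply: measurable_funM; first exact: measurable_tnth.
by apply: measurable_fun_inv; exact: measurable_tnth.
Qed.

Lemma measurable_ratio_set : measurable ratio_set.
Proof.
rewrite (_ : ratio_set = ratio_mean @^-1` `]-oo, z]%classic); last first.
  by apply/seteqP; split => v /=; rewrite in_itv.
rewrite -[X in measurable X]setTI; exact: measurable_fun_ratio_mean.
Qed.

(** By [ratio_rot], rotating by [t] shifts every angle atan (x_j / y_j) by - t, so the law for fixed
    angles applies. *)
Lemma lebesgue_ratio_set_rot (v : (m + m).-tuple R) :
  (forall i, tnth v i != 0) ->
  mu (O `&` [set t | ratio_set (tuple_rot (cos t) (sin t) v)]) =
  (pi / 2 + atan z)%:E.
Proof.
move=> v0.
pose al j := atan (tnth v (lshift m j) / tnth v (rshift m j)).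
rewrite -(@lebesgue_sum_tan_le R m al w z)//; last first.
  by move=> j; rewrite /= in_itv/= atan_gtNpi2 atan_ltpi2.
congr (mu (_ `&` _)); apply/seteqP; split => t; rewrite /ratio_set/= /ratio_mean;
  congr (_ <= _); apply: eq_bigr => j _; congr (_ * _);
  rewrite tnth_lshift tnth_rshift !tnth_mktuple ratio_rot//.
Qed.

(* Averaging the rotation invariance over the angle and exchanging the
   integrals leaves, for almost every [v], the law of [\sum w_j tan (a_j - t)]
   with [t] uniform. *)
Lemma iint_ratio_set (g : (m + m).-tuple R -> R) :
  measurable_fun setT g -> (forall v, 0 <= g v) ->
  (forall c s v, c ^+ 2 + s ^+ 2 = 1 -> g (tuple_rot c s v) = g v) ->
  ((pi : R)%:E * iint (fun v => (\1_ratio_set v * g v)%:E) =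
   (pi / 2 + atan z)%:E * iint (fun v => (g v)%:E))%E.
Proof.
move=> mg g0 g_rot.
have mS := measurable_ratio_set.
pose f v := (\1_ratio_set v * g v)%:E.
have f0 v : (0 <= f v)%E by rewrite lee_fin mulr_ge0.
have mf : measurable_fun setT f.
  by apply/measurable_EFinP; apply: measurable_funM => //; exact: measurable_indic.
(* The double integral of [F] over angle and vector is computed in both orders. *)
pose F (tv : measurableTypeR R * (m + m).-tuple R) :=
  ((\1_O tv.1)%:E * f (tuple_rot (cos tv.1) (sin tv.1) tv.2))%E.
have F0 tv : (0 <= F tv)%E by rewrite mule_ge0// lee_fin.
have mF : measurable_fun setT F.
  apply: emeasurable_funM.
    apply/measurable_EFinP; apply: (measurableT_comp (measurable_indic _)) => //.
  apply: (measurableT_comp mf); apply: measurable_fun_tuple_rot => //.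
    apply: (measurableT_comp (f := cos)) => //.
    by apply: continuous_measurable_fun; exact: continuous_cos.
  apply: (measurableT_comp (f := sin)) => //.
  by apply: continuous_measurable_fun; exact: continuous_sin.
have fE t v : f (tuple_rot (cos t) (sin t) v) =
    ((g v)%:E * (\1_ratio_set (tuple_rot (cos t) (sin t) v))%:E)%E.
  by rewrite /f g_rot ?cos2Dsin2// mulrC.
have LHS_E : (\int[mu]_t iint (fun v => F (t, v)) = (pi : R)%:E * iint f)%E.
  have -> : (pi : R)%:E = (\int[mu]_t (\1_O t)%:E)%E.
    have muO : mu O = (pi : R)%:E.
      rewrite lebesgue_measure_itv/= lte_fin; have pi0 := pi_gt0 R.
      by rewrite ifT; [rewrite -EFinB; congr (_%:E); field|lra].
    by rewrite integral_indic// setIT -[LHS]muO.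
  have If0 : (0 <= iint f)%E := iint_ge0 f0.
  rewrite -ge0_integralZr//; last first.
    by apply/measurable_EFinP; exact: measurable_indic.
  apply: eq_integral => t _; rewrite /F/= iintZl//; last first.
    by apply: (measurableT_comp mf); exact: measurable_fun_tuple_rot.
  have [Ot|nOt] := boolP (t \in O); last by rewrite indicE (negbTE nOt) !mul0e.
  (* For [t] in [O] the cosine is positive, so 1 + cos t is nonzero as the shear decomposition
     requires. *)
  rewrite iint_tuple_rot// ?cos2Dsin2//.
  rewrite gt_eqF// addr_gt0// cos_gt0_pihalf//.
  by move: Ot; rewrite inE/= in_itv.
have RHS_E : iint (fun v => \int[mu]_t F (t, v))%E =
    ((pi / 2 + atan z)%:E * iint (fun v => (g v)%:E))%E.
  have c0 : 0 <= pi / 2 + atan z by rewrite -lerBlDl sub0r ltW// atan_gtNpi2.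
  have mgE : measurable_fun setT (fun v => (g v)%:E) by exact/measurable_EFinP.
  rewrite -iintZl ?lee_fin//.
  apply: iint_eq_nonzero => //.
  - exact: (@measurable_fun_fubini_tonelli_G _ _ _ _ _ mu F).
  - by apply: emeasurable_funM => //; exact: measurable_cst.
  - by move=> v; apply: integral_ge0.
  - by move=> v; rewrite mule_ge0// lee_fin.
  (* For fixed [v], invariance takes [g v] out of the angular integral, which leaves the measure of
     the set [E] of angles. *)
  move=> v v0; rewrite /F/=.
  pose E := O `&` [set t | ratio_set (tuple_rot (cos t) (sin t) v)].
  have mE : measurable (E : set (measurableTypeR R)).
    apply: measurableI => //; rewrite -[X in measurable X]setTI.
    by apply: (@measurable_fun_tuple_rot _ _ _ (measurableTypeR R)) => //;
      apply: continuous_measurable_fun; [exact: continuous_cos|exact: continuous_sin].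
  have -> : (\int[mu]_t ((\1_O t)%:E * f (tuple_rot (cos t) (sin t) v)) =
      \int[mu]_t ((g v)%:E * (\1_E t)%:E))%E.
    apply: eq_integral => t _; rewrite fE muleCA; congr (_ * _)%E.
    by rewrite /E indicI -EFinM.
  rewrite ge0_integralZl ?lee_fin//; last first.
    by apply/measurable_EFinP.
  have muE : mu E = (pi / 2 + atan z)%:E := lebesgue_ratio_set_rot v0.
  by rewrite integral_indic// setIT [X in (_ * X)%E]muE muleC.
by rewrite -RHS_E -(@integral_iint _ _ _ mu _ F mF F0).
Qed.

End ratio_average.

(** * Application to densities built from quadratic forms *)

Lemma measurable_fun_qform (R : realType) (k : nat) (F : 'M[R]_k) :
  measurable_fun setT (fun v : k.-tuple R => qform F (row_of_tuple v)).
Proof.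
rewrite (_ : (fun v => _) = (fun v : k.-tuple R =>
  \sum_(i < k) (\sum_(j < k) tnth v j * F j i) * tnth v i)); last first.
  apply/funext => v; rewrite /qform mxE; apply: eq_bigr => i _.
  by rewrite !mxE; congr (_ * _); apply: eq_bigr => j _; rewrite mxE.
apply: measurable_sum => i; apply: measurable_funM; last exact: measurable_tnth.
apply: measurable_sum => j; apply: measurable_funM => //.
exact: measurable_tnth.
Qed.

Lemma tnth_joint_lshift (R : realType) (T : Type) (m : nat)
    (X Y : 'I_m -> T -> R) (t : T) (j : 'I_m) :
  tnth (joint X Y t) (lshift m j) = X j t.
Proof. by rewrite tnth_mktuple (unsplitK (inl _ j)). Qed.

Lemma tnth_joint_rshift (R : realType) (T : Type) (m : nat)
    (X Y : 'I_m -> T -> R) (t : T) (j : 'I_m) :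
  tnth (joint X Y t) (rshift m j) = Y j t.
Proof. by rewrite tnth_mktuple (unsplitK (inr _ j)). Qed.

Theorem theorem3p1 (R : realType) (m n : nat) (hm : (1 < m)%N) (hn : (0 < n)%N)
  (h : 'I_n -> R -> R)
  (h_meas : forall i, measurable_fun setT (h i))
  (h_ge0 : forall i x, 0 <= h i x)
  (A B : 'I_n -> 'M[R]_m)
  (A_sym : forall i, (A i)^T = A i)
  (B_anti : forall i, (B i)^T = - B i)
  (g := fun z : (m + m).-tuple R =>
          \prod_(i < n) h i (qform (blockF (A i) (B i)) (row_of_tuple z)))
  (g_int : (iint (fun z => (g z)%:E) < +oo)%E)
  (g_pos : (0 < iint (fun z => (g z)%:E))%E)
  (d : measure_display) (T : measurableType d) (P : probability T R)
  (X Y : 'I_m -> {mfun T >-> R}) (K : R)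
  (density : forall S : set ((m + m).-tuple R), measurable S ->
     P (joint (fun j => X j) (fun j => Y j) @^-1` S)
       = (K%:E * iint (fun z => (\1_S z * g z)%:E))%E)
  (w : 'I_m -> R) (w_ge0 : forall j, 0 <= w j) (w_sum : \sum_(j < m) w j = 1) :
  is_std_cauchy P (fun t => \sum_(j < m) w j * (X j t / Y j t))
  /\ (forall j : 'I_m, is_std_cauchy P (fun t => X j t / Y j t)).
Proof.
have g0 v : 0 <= g v by apply: prodr_ge0 => i _.
have mg : measurable_fun setT g.
  apply: measurable_prod => i _.
  by apply: (measurableT_comp (h_meas i)); exact: measurable_fun_qform.
have g_rot c s v : c ^+ 2 + s ^+ 2 = 1 -> g (tuple_rot c s v) = g v.
  by move=> cs; apply: eq_bigr => i _; rewrite qform_rot.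
have [j jE] : exists j : R, iint (fun v => (g v)%:E) = j%:E.
  exists (fine (iint (fun v => (g v)%:E))); rewrite fineK//.
  by rewrite ge0_fin_numE// iint_ge0.
(* The density formula on the whole space is the normalization of [K]. *)
have Kj : K * j = 1.
  have := density setT measurableT; rewrite preimage_setT probability_setT.
  rewrite (@eq_iint _ _ _ (fun v => (g v)%:E)); last first.
    by move=> v; rewrite indicT mul1r.
  by rewrite jE -EFinM => -[].
have pi0 : pi != 0 :> R by rewrite gt_eqF// pi_gt0.
(* The weights are left general so that point masses yield the individual ratios. *)
have main (u : 'I_m -> R) : (forall j, 0 <= u j) -> \sum_(j < m) u j = 1 ->
    is_std_cauchy P (fun t => \sum_(j < m) u j * (X j t / Y j t)).
  move=> u0 u1; apply: is_std_cauchy_cdf.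
    apply: measurable_sum => k; apply: measurable_funM => //.
    by apply: measurable_funM => //; exact: measurable_fun_inv.
  move=> z; rewrite (_ : _ @^-1` _ =
    joint (fun j => X j) (fun j => Y j) @^-1` ratio_set u z); last first.
    have E t : ratio_mean u (joint (fun j => X j) (fun j => Y j) t) =
        \sum_(j < m) u j * (X j t / Y j t).
      by apply: eq_bigr => i _; rewrite tnth_joint_lshift tnth_joint_rshift.
    by apply/seteqP; split => t; rewrite /ratio_set/= in_itv/= E.
  rewrite density; last exact: measurable_ratio_set.
  have := iint_ratio_set z u0 u1 mg g0 g_rot; rewrite jE.
  set I := iint _ => IE.
  have -> : I = ((pi / 2 + atan z) * j / pi)%:E.
    (* [I] is an extended real not yet known to be finite, so pi is cancelled by multiplying with
       its inverse. *)
    have : (pi^-1%:E * (pi%:E * I) = pi^-1%:E * ((pi / 2 + atan z)%:E * j%:E))%E.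
      by rewrite IE.
    rewrite muleA -EFinM mulVf// mul1e => ->.
    by rewrite -!EFinM; congr (_%:E); ring.
  rewrite -EFinM; congr (_%:E).
  transitivity (K * j * ((pi / 2 + atan z) / pi)); first by ring.
  by rewrite Kj mul1r mulrDl [_ / 2 / _]mulrAC divff// div1r.
split; first exact: main.
move=> k; have := main (fun j => (j == k)%:R).
rewrite (_ : (fun t => \sum_(j < m) _) = (fun t => X k t / Y k t)); last first.
  apply/funext => t; rewrite (bigD1 k)//= eqxx mul1r big1 ?addr0// => i /negbTE ->.
  by rewrite mul0r.
apply => //; rewrite (bigD1 k)//= eqxx big1 ?addr0// => i /negbTE ->.
by [].
Qed.
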